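(* Consider the Bayesian game described in the context. Suppose that for every $i\in N$ the following conditions hold. (a) $u_i(a,\theta)$ is continuous over $\mathcal{A}\times\Theta$, and for each $f_{-i}\in\mathcal{F}_{-i}$ and $\theta_i\in\Theta_i$, $\rho_i(\cdot,f_{-i},\theta_i)$ is strictly quasi-concave on $\mathcal{A}_i$. (b) For every measurable set $S\subset\Theta_{-i}$, $\eta_i(S|\theta_i)$ is continuous in $\theta_i$. (c) There exist positive constants $\alpha$ and $\nu$ such that for all $f_{-i}\in\mathcal{F}_{-i}$ and $\theta_i\in\Theta_i$, $$-\rho_i(a_i',f_{-i},\theta_i)\ \ge\ -v_i(f_{-i},\theta_i)+\alpha\, d\big(a_i',A_i^*(f_{-i},\theta_i)\big)^{\nu},\qquad \forall a_i'\in\mathcal{A}_i,$$ where $v_i(f_{-i},\theta_i):=\max_{a_i\in\mathcal{A}_i}\rho_i(a_i,f_{-i},\theta_i)$ and $A_i^*(f_{-i},\theta_i):=\arg\max_{a_i\in\mathcal{A}_i}\rho_i(a_i,f_{-i},\theta_i)$. (d) There exists a constant $\tau_i>0$ such that $|\rho_i(a_i,f_{-i},\theta_i)-\rho_i(a_i,f_{-i},\theta_i')|\le\tau_i\|\theta_i-\theta_i'\|$ for any $a_i\in\mathcal{A}_i$, $f_{-i}\in\mathcal{F}_{-i}$, $\theta_i,\theta_i'\in\Theta_i$. (e) $\mathcal{A}_i$ and $\Theta_i$ are compact and convex. Let $f\in\mathcal{C}$. Then $f$ is a (continuous) behavioural function equilibrium if and only if $$\mathbb{E}_\eta[u_i(f_i(\theta_i),f_{-i}(\theta_{-i}),\theta)]\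 \ge\ \mathbb{E}_\eta[u_i(g_i(\theta_i),f_{-i}(\theta_{-i}),\theta)],\qquad\forall g_i\in\mathcal{C}_i,\ i\in N,$$ or equivalently, if and only if $$f\in\arg\max_{g\in\mathcal{C}}\ \sum_{i=1}^n\mathbb{E}_\eta[u_i(g_i(\theta_i),f_{-i}(\theta_{-i}),\theta)].$$
   Context: Bayesian game: there are $n$ players, $N=\{1,\ldots,n\}$. For each $i$, the type set $\Theta_i\subset\mathbb{R}^{d_i}$ and the action space $\mathcal{A}_i\subset\mathbb{R}^{z_i}$ are non-empty. Put $\Theta=\Theta_1\times\cdots\times\Theta_n$, $\mathcal{A}=\mathcal{A}_1\times\cdots\times\mathcal{A}_n$; the subscript $-i$ denotes the vector (or product) over all players except $i$. Player $i$ has utility $u_i(a,\theta)=u_i(a_i,a_{-i},\theta_i,\theta_{-i})$. The types $\theta$ have joint probability distribution $\eta$ on $\Theta$, with marginal distribution $\eta_i$ of $\theta_i$; $\eta_i(\cdot|\theta_i)$ denotes the conditional probability distribution of $\theta_{-i}$ on $\Theta_{-i}$ given $\theta_i$, that is $\eta_i(\theta_{-i}|\theta_i)=\eta(\theta)/\eta_i(\theta_i)$, which is understood to be meaningful at every $\theta_i\in\Theta_i$; in particular the support of the marginal $\eta_i$ is all of $\Theta_i$. $\mathbb{E}_\eta$ is expectation with respect to $\eta$. $\mathcal{F}_i$ is the set of (measurable) functions $f_i:\Theta_i\to\mathcal{A}_i$ and $\mathcal{C}_i$ the set of continuous functions $f_i:\Theta_i\to\mathcal{A}_i$; $\mathcal{F}=\prod_i\mathcal{F}_i$,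 $\mathcal{C}=\prod_i\mathcal{C}_i$, $\mathcal{F}_{-i}=\prod_{j\ne i}\mathcal{F}_j$. For $a_i\in\mathcal{A}_i$, $f_{-i}\in\mathcal{F}_{-i}$, $\theta_i\in\Theta_i$, $$\rho_i(a_i,f_{-i},\theta_i):=\int_{\Theta_{-i}}u_i(a_i,f_{-i}(\theta_{-i}),\theta_i,\theta_{-i})\,d\eta_i(\theta_{-i}|\theta_i).$$ A behavioural function equilibrium is an $n$-tuple $f\in\mathcal{F}$ such that $f_i(\theta_i)\in\arg\max_{a_i\in\mathcal{A}_i}\rho_i(a_i,f_{-i},\theta_i)$ for every $\theta_i\in\Theta_i$ and every $i\in N$. $\|\cdot\|$ is the Euclidean norm and $d(x,B)=\inf_{b\in B}\|x-b\|$. A function $h$ on a convex set is strictly quasi-concave if $h(tx+(1-t)y)>\min\{h(x),h(y)\}$ for $x\neq y$, $t\in(0,1)$. *)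

(* Defs.v *)
From HB Require Import structures.
From mathcomp Require Import all_boot all_order all_algebra.
From mathcomp Require Import all_classical all_reals all_analysis.

Set Implicit Arguments.
Unset Strict Implicit.
Unset Printing Implicit Defensive.

Import Order.TTheory GRing.Theory Num.Theory.
Import numFieldNormedType.Exports.

Local Open Scope classical_set_scope.
Local Open Scope ring_scope.

(* Borel sigma-algebra. On a finite product of Euclidean spaces it coincides
   with the product sigma-algebra, these spaces being second countable. *)
Notation borel T := (g_sigma_algebraType (@open T)).

(* The topology induced by the sup norm that the library puts on row vectors
   is the Euclidean one; metric statements use the Euclidean norm below. *)
Definition enorm (R : realType) (m : nat) (x : 'rV[R]_m) : R :=
  Num.sqrt (\sum_j x 0 j ^+ 2).

Definition dist_set (R : realType) (m : nat) (x : 'rV[R]_m)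
    (B : set 'rV[R]_m) : R :=
  inf [set enorm (x - b) | b in B].

Definition argmax (R : realType) (T : Type) (D : set T) (h : T -> R) : set T :=
  [set x | D x /\ forall y, D y -> h y <= h x].

(* The maximum of [h] on [D], whenever it is attained. *)
Definition maxval (R : realType) (T : Type) (D : set T) (h : T -> R) : R :=
  sup [set h x | x in D].

Definition strictly_quasiconcave (R : realType) (m : nat) (D : set 'rV[R]_m)
    (h : 'rV[R]_m -> R) : Prop :=
  forall (x y : 'rV[R]_m) (t : R), D x -> D y -> x != y -> 0 < t -> t < 1 ->
    Num.min (h x) (h y) < h (t *: x + (1 - t) *: y).

Definition measure_support (R : realType) (T : ptopologicalType)
    (mu : set T -> \bar R) : set T :=
  [set x | forall U : set T, open U -> U x -> (0 < mu U)%E].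

Section Profiles.
Variable n : nat.

Definition opponent (i : 'I_n) : Type := {j : 'I_n | j != i}.

Definition others (T : 'I_n -> Type) (i : 'I_n) : Type :=
  forall j : opponent i, T (val j).

Definition drop_player (T : 'I_n -> Type) (i : 'I_n) (x : forall j, T j) :
    others T i :=
  fun j => x (val j).

Definition add_player (T : 'I_n -> Type) (i : 'I_n) (xi : T i)
    (x : others T i) : forall j, T j :=
  fun j => match boolP (j == i) with
           | AltTrue ji => eq_rect i T xi j (esym (eqP ji))
           | AltFalse ji => x (exist _ j ji)
           end.

Lemma add_player_eq (T : 'I_n -> Type) (i : 'I_n) (xi : T i)
    (x : others T i) : add_player xi x i = xi.
Proof.
rewrite /add_player; case: {-}_ / boolP => [ii|ii]; last first.
  by exfalso; move: (ii); rewrite eqxx.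
by rewrite (eq_axiomK (esym (eqP ii))).
Qed.

Lemma add_player_neq (T : 'I_n -> Type) (i : 'I_n) (xi : T i)
    (x : others T i) (j : opponent i) : add_player xi x (val j) = x j.
Proof.
case: j => j ji /=; rewrite /add_player.
case: {-}_ / boolP => [ji'|ji']; first by exfalso; move: (ji); rewrite ji'.
by rewrite (bool_irrelevance ji' ji).
Qed.

End Profiles.

Arguments drop_player {n T} i x.
Arguments add_player {n T i} xi x.

(* [vec_profile d] is the product of the spaces R^(d j) over all players, and
   [vec_others d i] the product over the opponents of [i]. *)
Definition vec_profile (R : realType) (n : nat) (d : 'I_n -> nat) : Type :=
  prod_topology (fun j : 'I_n => 'rV[R]_(d j)).

Definition vec_others (R : realType) (n : nat) (d : 'I_n -> nat) (i : 'I_n) :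
    Type :=
  prod_topology (fun j : opponent i => 'rV[R]_(d (val j))).

HB.instance Definition _ (R : realType) (n : nat) (d : 'I_n -> nat) :=
  Topological.on (vec_profile R d).
HB.instance Definition _ (R : realType) (n : nat) (d : 'I_n -> nat) :=
  isPointed.Build (vec_profile R d) (fun j => 0).
HB.instance Definition _ (R : realType) (n : nat) (d : 'I_n -> nat)
    (i : 'I_n) := Topological.on (vec_others R d i).
HB.instance Definition _ (R : realType) (n : nat) (d : 'I_n -> nat)
    (i : 'I_n) := isPointed.Build (vec_others R d i) (fun j => 0).

Definition coord (R : realType) (n : nat) (d : 'I_n -> nat) (i : 'I_n)
    (x : borel (vec_profile R d)) : borel 'rV[R]_(d i) := x i.

Lemma measurable_coord (R : realType) (n : nat) (d : 'I_n -> nat) (i : 'I_n) :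
  measurable_fun setT (@coord R n d i).
Proof.
apply: (@measurability _ _ (borel (vec_profile R d)) (borel 'rV[R]_(d i)) setT
  (@coord R n d i) (@open 'rV[R]_(d i))) => //.
move=> _ [U oU <-]; rewrite setTI; apply: sub_sigma_algebra.
apply: open_comp => // x _.
exact: (@proj_continuous _ (fun j => 'rV[R]_(d j)) i).
Qed.

HB.instance Definition _ (R : realType) (n : nat) (d : 'I_n -> nat)
    (i : 'I_n) :=
  isMeasurableFun.Build _ _ _ _ (@coord R n d i) (@measurable_coord R n d i).

Unset Implicit Arguments.

(* Type and action sets are subsets of Euclidean spaces, so utilities, prior
   and conditionals are given on the ambient spaces; only their values on the
   products of the sets [types i] and [actions i] matter. *)
Record bayesian_game (R : realType) (n : nat) := BayesianGame {
  tdim : 'I_n -> nat;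
  adim : 'I_n -> nat;
  types : forall i : 'I_n, set 'rV[R]_(tdim i);
  actions : forall i : 'I_n, set 'rV[R]_(adim i);
  types_neq0 : forall i, types i !=set0;
  actions_neq0 : forall i, actions i !=set0;
  utility : 'I_n -> vec_profile R adim -> vec_profile R tdim -> R;
  prior : probability (borel (vec_profile R tdim)) R;
  prior_types :
    prior [set th : vec_profile R tdim | forall i, types i (th i)] = 1%E;
  (* [cond i x] is the conditional distribution of the opponents' types given
     that the type of [i] is [x] *)
  cond : forall i : 'I_n,
    R.-pker (borel 'rV[R]_(tdim i)) ~> (borel (vec_others R tdim i));
  cond_types : forall i x, types i x ->
    cond i x [set y : vec_others R tdim i |
      forall j : opponent i, types (val j) (y j)] = 1%E;
  (* the prior is the marginal times the conditional, for general measures *)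
  cond_prior : forall (i : 'I_n) (B : set (borel 'rV[R]_(tdim i)))
      (S : set (borel (vec_others R tdim i))),
    measurable B -> measurable S ->
    prior [set th : vec_profile R tdim | B (th i) /\ S (drop_player i th)] =
    (\int[distribution prior (@coord R n tdim i)]_(x in B) cond i x S)%E;
  (* so that conditioning is meaningful at every type *)
  marginal_support : forall i,
    measure_support (distribution prior (@coord R n tdim i)) = types i }.

Arguments tdim {R n} _ _.
Arguments adim {R n} _ _.
Arguments types {R n} _ _ _.
Arguments actions {R n} _ _ _.
Arguments utility {R n} _ _ _ _.
Arguments prior {R n} _.
Arguments cond {R n} _ _.

Section Game.
Context {R : realType} {n : nat} (G : bayesian_game R n).

Definition type_profiles : set (vec_profile R (tdim G)) :=
  [set th | forall i, types G i (th i)].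

Definition action_profiles : set (vec_profile R (adim G)) :=
  [set a | forall i, actions G i (a i)].

Definition others_types (i : 'I_n) : set (vec_others R (tdim G) i) :=
  [set y | forall j : opponent i, types G (val j) (y j)].

Definition strategy (i : 'I_n) : Type :=
  'rV[R]_(tdim G i) -> 'rV[R]_(adim G i).

Definition feasible (i : 'I_n) (fi : strategy i) : Prop :=
  forall x, types G i x -> actions G i (fi x).

Definition measurable_strategies (i : 'I_n) : set (strategy i) :=
  [set fi | feasible i fi /\
    measurable_fun (types G i : set (borel 'rV[R]_(tdim G i)))
      (fi : borel 'rV[R]_(tdim G i) -> borel 'rV[R]_(adim G i))].

Definition continuous_strategies (i : 'I_n) : set (strategy i) :=
  [set fi | feasible i fi /\ {within types G i, continuous fi}].

Definition measurable_others (i : 'I_n) : set (others strategy i) :=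
  [set fo | forall j, measurable_strategies (val j) (fo j)].

Definition rho (i : 'I_n) (a : 'rV[R]_(adim G i)) (fo : others strategy i)
    (x : 'rV[R]_(tdim G i)) : R :=
  \int[cond G i x]_(y in others_types i)
    utility G i (add_player a (fun j => fo j (y j))) (add_player x y).

Definition behavioural_equilibrium (f : forall i, strategy i) : Prop :=
  (forall i, measurable_strategies i (f i)) /\
  forall i x, types G i x ->
    argmax (actions G i) (fun a => rho i a (drop_player i f) x) (f i x).

(* Expected utility of [i] under the prior when [i] plays [gi] and the
   opponents play as in [f]. *)
Definition expected_utility (i : 'I_n) (gi : strategy i)
    (f : forall j, strategy j) : R :=
  \int[prior G]_(th in type_profiles)
    utility G i
      (add_player (gi (th i)) (fun j : opponent i => f (val j) (th (val j))))
      th.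

End Game.

(* Main.v *)
Require Import Defs.
From HB Require Import structures.
From mathcomp Require Import all_boot all_order all_algebra.
From mathcomp Require Import all_classical all_reals all_analysis.
From mathcomp Require Import measurable_realfun lra.
Import Order.TTheory GRing.Theory Num.Theory.
Import numFieldNormedType.Exports.

(** Fix the opponents' continuous strategies. By disintegration, the ex ante
    payoff of player [i] from a continuous strategy [g] is the integral of the
    interim payoff [rho i (g x)] at type [x] against the marginal distribution
    of the types of [i] ([expected_utility_rho]). If [f i x] maximizes the
    interim payoff at every [x], monotonicity of the integral shows that no
    continuous [g] does better ex ante.

    For the converse, the pointwise maximizer is itself an admissible deviation:
    the interim payoff has a unique maximizer at each type, since it is
    continuous and strictly quasi-concave on a compact convex set, and this
    maximizer is Hoelder continuous in the type ([best_reply_holder]). Indeed,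
    moving the type by [r] moves every interim payoff by at most [tau * r], so
    the maximizer at the new type loses at most [2 * tau * r] at the old one,
    and the growth condition turns a small loss into a small distance. So a
    strategy [f i] that no continuous strategy improves upon ex ante has the
    same integrated payoff as the pointwise maximizer, whose interim payoff
    dominates it everywhere. Both interim payoffs are continuous in the type and
    the marginal charges every neighbourhood of every type, hence they agree at
    every type, not only almost surely ([eq_of_marginal_Rintegral_le]), and
    [f i x] is a maximizer too.

    The sum over the players is maximal exactly when each summand is, because a
    single player's strategy can be changed while the others are kept.

    Disintegration is given on measurable rectangles only. It extends to
    functions measurable for the product sigma-algebra
    ([Rintegral_disintegration]); a function continuous on a product is
    measurable in that sense because one of the factors is a Euclidean space,
    hence second countable ([open_measurable_prod]). *)

Set Implicit Arguments.
Unset Strict Implicit.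
Unset Printing Implicit Defensive.

Local Open Scope classical_set_scope.
Local Open Scope ring_scope.

(** * Continuity within a set *)

Lemma cvg_prod_topology {I : Type} {K : I -> topologicalType} {S : Type}
    (F : set_system S) {FF : Filter F} (h : S -> prod_topology K)
    (z : prod_topology K) :
  (forall i, (fun s => h s i) @ F --> z i) -> h @ F --> z.
Proof.
move=> hz; apply/cvg_sup => i U [_ [[W oW <-] Wz WU]].
by rewrite nbhs_simpl; apply: (filterS WU); apply: hz; exact: open_nbhs_nbhs.
Qed.

(** Utilities and strategies are continuous on prescribed sets only, hence the
    outer function is also taken within a set. *)
Lemma within_comp_continuous {S T U : topologicalType} {K : set S} {B : set T}
    (h : S -> T) (u : T -> U) :
  (forall s, K s -> B (h s)) ->
  {within K, continuous h} -> {within B, continuous u} ->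
  {within K, continuous (u \o h)}.
Proof.
move=> hKB /subspace_continuousP ch /subspace_continuousP cu.
apply/subspace_continuousP => s Ks; apply: cvg_comp (cu _ (hKB _ Ks)).
move=> V; rewrite nbhs_simpl /within/= => BV.
have := ch _ Ks _ BV; rewrite !nbhs_simpl /within/=.
by apply: filterS => s' BV' Ks'; apply: (BV' Ks'); exact: hKB.
Qed.

Lemma within_continuous_section {S T U : topologicalType} {A : set S}
    {B : set T} (h : S * T -> U) (a : S) :
  A a -> {within A `*` B, continuous h} ->
  {within B, continuous (fun y => h (a, y))}.
Proof.
move=> Aa; apply: (@within_comp_continuous _ _ _ B (A `*` B) (pair a) h) => //.
apply: continuous_subspaceT => y.
by apply: cvg_pair; [exact: cvg_cst|exact: cvg_id].
Qed.

Lemma within_continuous_bounded {R : realType} {T : topologicalType}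
    {A : set T} {h : T -> R} :
  compact A -> {within A, continuous h} ->
  exists M, forall x, A x -> `|h x| <= M.
Proof.
move=> cA ch; have /compact_bounded[M [_ hM]] := continuous_compact ch cA.
exists (M + 1) => x Ax; apply: hM; first by rewrite ltrDl.
by exists x.
Qed.

(** The tube lemma: compactness of [B] makes the modulus of continuity at [a]
    uniform over [B]. *)
Lemma within_continuous_uniform_section {R : realType} {S T : topologicalType}
    {A : set S} {B : set T} (h : S * T -> R) (a : S) (e : R) :
  compact B -> {within A `*` B, continuous h} -> A a -> 0 < e ->
  \forall a' \near within A (nbhs a),
    forall y, B y -> `|h (a, y) - h (a', y)| < e.
Proof.
move=> /compact_near_coveringP/near_covering_withinP cB.
move=> /subspace_continuousP ch Aa e0.
apply: (cB S (within A (nbhs a)) (fun a' y => `|h (a, y) - h (a', y)| < e)).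
move=> y By.
have /cvgrPdist_lt/(_ (e / 2)) := ch (a, y) (conj Aa By).
rewrite divr_gt0// => /(_ isT)[[P Q] /= [Pa Qy] PQ].
exists (Q, P `&` A) => /=.
  split => //; rewrite /within/=.
  by apply: filterS Pa => a' Pa' Aa'.
move=> [y' a'] /= [Qy' [Pa' Aa'] By'].
have hay' : `|h (a, y) - h (a, y')| < e / 2.
  by apply: (PQ (a, y')) => //; split => //=; exact: nbhs_singleton.
have ha'y' : `|h (a, y) - h (a', y')| < e / 2 by exact: (PQ (a', y')).
rewrite [e]splitr -(subrKA (h (a, y))).
apply: le_lt_trans (ler_normD _ _) _; apply: ltrD => //.
by rewrite distrC.
Qed.

(** * Measurability and integrability of continuous functions *)

Lemma compact_measurable_borel {T : ptopologicalType} (A : set (borel T)) :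
  hausdorff_space T -> compact (A : set T) -> measurable A.
Proof.
move=> hT /(compact_closed hT) /closed_openC oA; rewrite -[A]setCK.
by apply: measurableC; exact: sub_sigma_algebra.
Qed.

Lemma within_continuous_measurable {T U : ptopologicalType}
    (D : set (borel T)) (h : T -> U) :
  measurable D -> {within (D : set T), continuous h} ->
  measurable_fun D (h : borel T -> borel U).
Proof.
move=> mD /continuousP ch.
apply: (@measurability _ _ (borel T) (borel U) D h (@open U)) => //.
move=> _ [V oV <-]; have /open_subspaceP[W oW WD] := ch _ oV.
by rewrite setIC -WD; apply: measurableI => //; exact: sub_sigma_algebra.
Qed.

Lemma within_continuous_measurable_realfun {R : realType} {T : ptopologicalType}
    (D : set (borel T)) (h : T -> R) :
  measurable D -> {within (D : set T), continuous h} ->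
  measurable_fun D (h : borel T -> R).
Proof.
move=> mD /continuousP ch; apply: (measurability _ (RGenOpens.measurableE R)).
move=> _ [_ [a [b ->] <-]].
have /ch/open_subspaceP[W oW WD] : open `]a, b[%classic by exact: interval_open.
by rewrite setIC -WD; apply: measurableI => //; exact: sub_sigma_algebra.
Qed.

(** The basis consists of the balls with rational center and radius
    [1 / (N + 1)]. *)
Lemma second_countable_rV (R : realType) (m : nat) :
  @second_countable 'rV[R]_m.
Proof.
pose B (c : 'rV[rat]_m * nat) : set 'rV[R]_m :=
  ball (map_mx ratr c.1 : 'rV[R]_m) (c.2.+1%:R^-1).
exists (range B).
  by apply: (sub_countable (card_image_le _ _)); exact: countableP.
split; first by move=> _ [c _ <-]; apply: ball_open; rewrite invr_gt0.
move=> x V /nbhs_ballP[e /= e0 xV].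
have [N Ne] : exists N : nat, N.+1%:R^-1 < e / 2.
  have [|N] := @ltr_add_invr R 0 (e / 2); first by rewrite divr_gt0.
  by rewrite add0r; exists N.
have dense j : exists q : rat, ball (x 0 j) N.+1%:R^-1 (ratr q : R).
  have : x 0 j - N.+1%:R^-1 < x 0 j + N.+1%:R^-1.
    by rewrite ltrD2l gtrN ?invr_gt0.
  move=> /rat_in_itvoo[q]; rewrite in_itv/= => /andP[q1 q2]; exists q.
  by rewrite /ball/= ltr_distlC q1.
have {dense}[c xc] : exists c : 'rV[rat]_m,
    ball x N.+1%:R^-1 (map_mx ratr c : 'rV[R]_m).
  have [q xq] := choice dense; exists (\row_j q j); split=> [|i j].
    by rewrite invr_gt0.
  by rewrite !mxE ord1.
exists (B (c, N)).
  by split; [exists (c, N)|exact: ball_sym].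
move=> y cy; apply: xV; rewrite [e]splitr.
apply: ball_triangle (le_ball (ltW Ne) xc) _.
exact: le_ball (ltW Ne) _ _.
Qed.

(** An open set is a countable union of open rectangles [U `*` V U], where [U]
    runs through a countable basis of [X] and [V U] is the largest open set with
    [U `*` V U] inside it. Second countability of one factor is enough. *)
Lemma open_measurable_prod {X Y : ptopologicalType} (W : set (X * Y)) :
  @second_countable X -> open W ->
  measurable (W : set (borel X * borel Y)).
Proof.
move=> [B cB [oB bB]] oW.
pose V U := \bigcup_(V in [set V : set Y | open V /\ U `*` V `<=` W]) V.
have -> : W = \bigcup_(U in B) (U `*` V U).
  apply/seteqP; split=> [[x y] Wxy|[x y] [U BU [/= Ux [V' [oV' UVW] V'y]]]].
    move: oW; rewrite openE => /(_ _ Wxy) [[P Q] /= [/bB[U [BU Ux] UP]]].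
    rewrite /= nbhsE => -[Q' [oQ' Q'y] Q'Q] PQW; exists U => //; split => //=.
    exists Q' => //; split => // -[x' y'] [/= Ux' Q'y'].
    by apply: PQW; split => /=; [exact: UP|exact: Q'Q].
  exact: UVW.
rewrite bigcup_set_type; apply: countable_bigcupT_measurable => [|[U BU] /=].
  by rewrite (eq_countable (card_setT B)).
apply: measurableX; apply: sub_sigma_algebra.
  by apply: oB; exact: set_mem BU.
by apply: bigcup_open => V' [].
Qed.

Lemma within_continuous_measurable_prod {R : realType} {X Y : ptopologicalType}
    (K : set (borel X * borel Y)) (h : X * Y -> R) :
  @second_countable X -> measurable K ->
  {within (K : set (X * Y)), continuous h} ->
  measurable_fun K (h : borel X * borel Y -> R).
Proof.
move=> X2 mK /continuousP ch.
apply: (measurability _ (RGenOpens.measurableE R)).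
move=> _ [_ [a [b ->] <-]].
have /ch/open_subspaceP[W oW WK] : open `]a, b[%classic by exact: interval_open.
by rewrite setIC -WK; apply: measurableI => //; exact: open_measurable_prod.
Qed.

Lemma bounded_fun_integrable {R : realType} {d} {T : measurableType d}
    (mu : {measure set T -> \bar R}) (A : set T) (h : T -> R) (M : R) :
  measurable A -> (mu A < +oo)%E -> measurable_fun A h ->
  (forall x, A x -> `|h x| <= M) -> mu.-integrable A (EFin \o h).
Proof.
move=> mA muA mh hM; apply: measurable_bounded_integrable => //.
exists M; split; first exact: num_real.
by move=> r Mr x Ax; apply: le_trans (ltW Mr); exact: hM.
Qed.

Lemma within_continuous_integrable {R : realType} {T : ptopologicalType}
    (mu : {measure set (borel T) -> \bar R}) (A : set (borel T)) (h : T -> R) :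
  measurable A -> (mu A < +oo)%E ->
  compact (A : set T) -> {within (A : set T), continuous h} ->
  mu.-integrable A (EFin \o h).
Proof.
move=> mA muA cA ch; have [M hM] := within_continuous_bounded cA ch.
apply: (bounded_fun_integrable mA muA _ hM).
exact: within_continuous_measurable_realfun.
Qed.

Lemma within_continuous_Rintegral {R : realType} {S : topologicalType}
    {T : ptopologicalType} (mu : {measure set (borel T) -> \bar R})
    (A : set S) (B : set (borel T)) (h : S * T -> R) :
  measurable B -> mu B = 1%E -> compact (B : set T) ->
  {within A `*` (B : set T), continuous h} ->
  {within A, continuous (fun a => \int[mu]_(y in B) h (a, y))}.
Proof.
move=> mB muB cB ch.
have ih a : A a -> mu.-integrable B (EFin \o (fun y => h (a, y))).
  move=> Aa; apply: within_continuous_integrable => //.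
    by rewrite muB ltry.
  exact: (within_continuous_section Aa ch).
apply/subspace_continuousP => a Aa; apply/cvgrPdist_le => e e0.
have := within_continuous_uniform_section cB ch Aa e0.
rewrite !near_withinE; apply: filterS => a' + Aa' => /(_ Aa') haa'.
have iB : mu.-integrable B (EFin \o (fun y => h (a, y) - h (a', y))).
  by apply: (integrableB mB (ih a Aa) (ih a' Aa')).
rewrite -RintegralB//; try exact: ih.
apply: le_trans (le_normr_Rintegral mB iB) _.
have -> : e = \int[mu]_(y in B) e by rewrite Rintegral_cst// muB mulr1.
apply: le_Rintegral => //.
- exact: integrable_norm.
- have := @within_continuous_integrable R T mu B (cst e); apply => //.
    by rewrite muB ltry.
  exact: cst_continuous.
- by move=> y /haa' /ltW.
Qed.

(** A continuous function that is positive at one point of the support is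
    bounded below by a positive constant on a set of positive measure. *)
Lemma eq0_of_Rintegral_le0 {R : realType} {T : ptopologicalType}
    (mu : probability (borel T) R) (A : set (borel T)) (h : T -> R) :
  measurable A -> mu A = 1%E -> A `<=` measure_support mu ->
  mu.-integrable A (EFin \o h) ->
  {within (A : set T), continuous h} -> (forall x, A x -> 0 <= h x) ->
  \int[mu]_(x in A) h x <= 0 -> forall x, A x -> h x = 0.
Proof.
move=> mA muA Asupp ih /subspace_continuousP ch h0 inth x Ax.
apply/eqP; rewrite eq_le h0// andbT leNgt; apply/negP => hx.
have /cvgrPdist_lt/(_ (h x / 2)) := ch x Ax.
rewrite divr_gt0// => /(_ isT); rewrite near_withinE /prop_near1 nbhsE.
move=> [U [oU Ux] hU].
have mU : measurable (U : set (borel T)) by exact: sub_sigma_algebra.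
have mAU : measurable (A `&` U : set (borel T)) by exact: measurableI.
have muAU : (0 < mu (A `&` U))%E.
  have : (0 < mu U)%E by exact: (Asupp x Ax).
  rewrite (measureDI mu mU mA) (setIC U A).
  rewrite (@subset_measure0 _ _ _ mu _ (~` A)) ?add0e//.
  - exact: measurableD.
  - exact: measurableC.
  - by rewrite /= probability_setC// muA subee.
have : \int[mu]_(y in A `&` U) (h x / 2) <= \int[mu]_(y in A) h y.
  rewrite Rintegral_mkcondr; apply: le_Rintegral => //.
    rewrite -restrict_EFin; apply/(integrable_restrict mu mU mA).
    exact: finite_measure_integrable_cst.
  move=> y Ay; rewrite patchE; case: ifPn => [/set_mem Uy|_]; last exact: h0.
  have : h x - h y < h x / 2 by exact: le_lt_trans (ler_norm _) (hU y Uy Ay).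
  by lra.
rewrite Rintegral_cst// leNgt => /negP; apply; apply: le_lt_trans inth _.
rewrite mulr_gt0 ?divr_gt0// fine_gt0// muAU/=.
by rewrite (le_lt_trans (probability_le1 mu mAU))// ltry.
Qed.

(** * Disintegration *)

Section Disintegration.
Context d0 d1 d2 (W : measurableType d0) (X : measurableType d1)
  (Y : measurableType d2) (R : realType).
Variables (P : probability W R) (p : {mfun W >-> X}) (q : {mfun W >-> Y}).
Variable k : R.-pker X ~> Y.
Hypothesis Pk : forall B S, measurable B -> measurable S ->
  P (p @^-1` B `&` q @^-1` S) = (\int[distribution P p]_(x in B) k x S)%E.

(* The joint law of [p] and [q] is the composition of the law of [p], seen as a
   kernel from the one-point space, with the kernel [x |-> delta_x \x k x]. *)
Let const_ker (_ : unit) : {measure set X -> \bar R} := distribution P p.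

Let measurable_const_ker U : measurable U ->
  measurable_fun [set: unit] (const_ker ^~ U).
Proof. by move=> mU; exact: (measurable_cst (distribution P p U)). Qed.

HB.instance Definition _ :=
  isKernel.Build _ _ _ _ R const_ker measurable_const_ker.

Let const_ker_prob x : const_ker x [set: X] = 1%E.
Proof. exact: probability_setT. Qed.

HB.instance Definition _ :=
  Kernel_isProbability.Build _ _ _ _ _ const_ker const_ker_prob.

Let pair_at (x : X) (y : Y) : X * Y := (x, y).

Let measurable_pair_at x : measurable_fun setT (pair_at x).
Proof. exact: pair1_measurable. Qed.

Let graph_ker (z : unit * X) : {measure set (X * Y) -> \bar R}.
Proof.
by refine (pushforward (k z.2) (pair_at z.2)); exact: measurable_pair_at.
Defined.

Let measurable_graph_ker U : measurable U ->
  measurable_fun [set: unit * X] (graph_ker ^~ U).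
Proof.
move=> mU; rewrite [X in measurable_fun _ X](_ : _ =
    (fun x => k x (xsection U x)) \o snd); last first.
  by apply/funext => -[u x] /=; rewrite /graph_ker/= /pushforward xsectionE.
apply: measurableT_comp (@measurable_snd _ _ _ _).
by apply: measurable_fun_xsection_finite_kernel; rewrite inE.
Qed.

HB.instance Definition _ :=
  isKernel.Build _ _ _ _ R graph_ker measurable_graph_ker.

Let graph_ker_prob z : graph_ker z [set: X * Y] = 1%E.
Proof. by rewrite /graph_ker/= /pushforward preimage_setT prob_kernel. Qed.

HB.instance Definition _ :=
  Kernel_isProbability.Build _ _ _ _ _ graph_ker graph_ker_prob.

Let joint (w : W) : X * Y := (p w, q w).

Let measurable_joint : measurable_fun setT joint.
Proof. exact: measurable_fun_pair. Qed.

HB.instance Definition _ :=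
  isMeasurableFun.Build _ _ _ _ joint measurable_joint.

(** Two probability measures on a product that agree on rectangles are equal. *)
Lemma ge0_integral_disintegration (F : X * Y -> \bar R) :
  measurable_fun setT F -> (forall z, 0 <= F z)%E ->
  (\int[P]_w F (p w, q w) =
   \int[distribution P p]_x \int[k x]_y F (x, y))%E.
Proof.
move=> mF F0.
transitivity (\int[distribution P joint]_z F z)%E.
  by rewrite ge0_integral_pushforward.
transitivity (\int[kcomp const_ker graph_ker tt]_z F z)%E.
  apply: eq_measure_integral => A mA _.
  pose C := [set B `*` S | B in @measurable _ X & S in @measurable _ Y].
  apply: (measure_unique C (fun=> setT)) => //.
  - exact: measurable_prod_measurableType.
  - move=> _ _ [B1 mB1 [S1 mS1 <-]] [B2 mB2 [S2 mS2 <-]]; rewrite -setXI.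
    exists (B1 `&` B2); first exact: measurableI.
    by exists (S1 `&` S2) => //; exact: measurableI.
  - by move=> _; exists setT => //; exists setT => //; rewrite setXTT.
  - by apply/seteqP; split=> // z _; exists 0%N.
  - move=> _ [B mB [S mS <-]].
    rewrite /= /distribution /pushforward [LHS]Pk//.
    rewrite /kcomp/= integral_mkcond; apply: eq_integral => x _.
    rewrite /graph_ker/= /pushforward patchE; case: ifPn => xB.
      congr (k x _); apply/seteqP; split=> y /=; last by case.
      by move=> Sy; split => //; exact: set_mem.
    rewrite (_ : _ @^-1` _ = set0) ?measure0//.
    apply/seteqP; split=> y //= [Bx _].
    by move: xB; rewrite notin_setE.
  - by move=> _; rewrite /= probability_setT ltry.
rewrite integral_kcomp//; apply: eq_integral => x _.
by rewrite /= ge0_integral_pushforward.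
Qed.

Let Rintegral_disintegrationT (F : X * Y -> R) (M : R) :
  measurable_fun setT F -> (forall z, `|F z| <= M) ->
  \int[P]_w F (p w, q w) = \int[distribution P p]_x \int[k x]_y F (x, y).
Proof.
(* the constant [M] reduces the claim to a nonnegative function *)
move=> mF FM; pose G z := F z + M.
have mG : measurable_fun setT G by apply: measurable_funD.
have G0 z : 0 <= G z.
  by rewrite -lerBlDr sub0r; have := FM z; rewrite ler_norml => /andP[].
have kT x : k x setT = 1%E by exact: prob_kernel.
have iFk x : (k x).-integrable setT (EFin \o (fun y => F (x, y))).
  apply: (@bounded_fun_integrable _ _ _ _ _ _ M) => //.
    by rewrite kT ltry.
  exact: (measurableT_comp mF (pair1_measurable _)).
have cstk x c : \int[k x]_y c = c by rewrite Rintegral_cst//= kT mulr1.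
have ick x c : (k x).-integrable setT (EFin \o cst c).
  by apply: (@bounded_fun_integrable _ _ _ _ _ _ `|c|) => //; rewrite kT ltry.
have GkE x : \int[k x]_y G (x, y) = \int[k x]_y F (x, y) + M.
  by rewrite (RintegralD measurableT (iFk x) (ick x M)) cstk.
have mpq : measurable_fun setT (fun w => (p w, q w)).
  by apply: measurable_fun_pair.
have PT : (P : {measure set W -> \bar R}) setT = 1%E.
  exact: probability_setT.
have QT : (distribution P p : {measure set X -> \bar R}) setT = 1%E.
  exact: probability_setT.
have iFP : P.-integrable setT (EFin \o (fun w => F (p w, q w))).
  apply: (@bounded_fun_integrable _ _ _ _ _ _ M) => //.
    by rewrite PT ltry.
  exact: (measurableT_comp mF mpq).
have icP : P.-integrable setT (EFin \o cst M).
  exact: finite_measure_integrable_cst.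
have GPE : \int[P]_w G (p w, q w) = \int[P]_w F (p w, q w) + M.
  rewrite (RintegralD measurableT iFP icP); congr (_ + _).
  by rewrite Rintegral_cst// PT mulr1.
have gfin x : (\int[k x]_y (G (x, y))%:E)%E \is a fin_num.
  apply: integrable_fin_num => //.
  exact: (integrableD measurableT (iFk x) (ick x M)).
have mg : measurable_fun setT (fun x => \int[k x]_y G (x, y)).
  apply: (@measurableT_comp _ _ _ _ _ _ fine) => //.
  apply: (measurable_fun_integral_finite_kernel (EFin \o G)) => //.
  exact/measurable_EFinP.
have iF : (distribution P p).-integrable setT
    (EFin \o (fun x => \int[k x]_y F (x, y))).
  apply: (@bounded_fun_integrable _ _ _ _ _ _ M) => //.
  - by rewrite QT ltry.
  - rewrite [X in measurable_fun _ X](_ : _ =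
        (fun x => \int[k x]_y G (x, y) - M)).
      exact: measurable_funB.
    by apply/funext => x; rewrite GkE addrK.
  - move=> x _; apply: le_trans (le_normr_Rintegral measurableT (iFk x)) _.
    rewrite -[leRHS](cstk x); apply: le_Rintegral => //.
      exact: integrable_norm.
    exact: ick.
have : \int[P]_w G (p w, q w) =
    \int[distribution P p]_x \int[k x]_y G (x, y).
  rewrite /Rintegral; congr fine.
  rewrite (@ge0_integral_disintegration (EFin \o G))//.
    by apply: eq_integral => x _; rewrite fineK.
  exact/measurable_EFinP.
rewrite GPE; under [in RHS]eq_Rintegral do rewrite GkE.
have icX : (distribution P p).-integrable setT (EFin \o cst M).
  exact: finite_measure_integrable_cst.
rewrite (RintegralD measurableT iF icX).
by rewrite Rintegral_cst// QT mulr1 => /addIr.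
Qed.

Lemma Rintegral_disintegration (A : set X) (B : set Y) (F : X * Y -> R)
    (M : R) :
  measurable A -> measurable B -> measurable_fun (A `*` B) F ->
  (forall x y, A x -> B y -> `|F (x, y)| <= M) ->
  \int[P]_(w in [set w | A (p w) /\ B (q w)]) F (p w, q w) =
  \int[distribution P p]_(x in A) \int[k x]_(y in B) F (x, y).
Proof.
move=> mA mB mF FM.
have mAB : measurable (A `*` B) by exact: measurableX.
have := @Rintegral_disintegrationT (F \_ (A `*` B)) `|M|.
rewrite -measurable_restrictT// => /(_ mF) E.
rewrite Rintegral_mkcond [RHS]Rintegral_mkcond.
transitivity (\int[P]_w (F \_ (A `*` B)) (p w, q w)).
  apply: eq_Rintegral => w _; rewrite !patchE.
  by congr (if _ then _ else _); apply/idP/idP; rewrite !inE.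
rewrite E.
  apply: eq_Rintegral => x _; rewrite patchE; case: ifPn => [/set_mem Ax|nAx].
    rewrite [RHS]Rintegral_mkcond; apply: eq_Rintegral => y _; rewrite !patchE.
    by congr (if _ then _ else _); apply/idP/idP; rewrite !inE// => -[].
  rewrite (@eq_Rintegral _ _ _ _ _ (cst 0)) ?Rintegral_cst ?mul0r//.
  move=> y _; rewrite patchE ifF//; apply/negbTE; move: nAx.
  by rewrite !notin_setE => nAx [].
move=> [x y]; rewrite patchE; case: ifPn => [/set_mem[/= Ax By]|_].
  by apply: le_trans (ler_norm M); exact: FM.
by rewrite normr0.
Qed.

End Disintegration.

(** * Profiles and norms *)

Section Profiles.
Context {R : realType} {n : nat} {d : 'I_n -> nat}.
Implicit Type i : 'I_n.

Lemma cvg_coord i (z : vec_profile R d) :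
  (fun x : vec_profile R d => x i) @ z --> z i.
Proof. exact: (@proj_continuous _ (fun j => 'rV[R]_(d j)) i). Qed.

Lemma cvg_coord_others i (j : opponent i) (z : vec_others R d i) :
  (fun x : vec_others R d i => x j) @ z --> z j.
Proof.
exact: (@proj_continuous _ (fun j : opponent i => 'rV[R]_(d (val j))) j).
Qed.

Lemma drop_player_continuous i :
  continuous (fun x : vec_profile R d => drop_player i x : vec_others R d i).
Proof.
move=> z; apply: (@cvg_prod_topology _ _ _ _ (nbhs_filter z)) => j.
exact: cvg_coord.
Qed.

Lemma add_drop_player (T : 'I_n -> Type) i (x : forall j, T j) :
  add_player (x i) (drop_player i x) = x.
Proof.
apply: functional_extensionality_dep => j.
have [->|ji] := eqVneq j i; first by rewrite add_player_eq.
exact: (add_player_neq (x i) (drop_player i x) (exist _ j ji)).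
Qed.

Lemma add_playerP (T : 'I_n -> Type) (P : forall j, T j -> Prop) i (xi : T i)
    (x : others T i) :
  P i xi -> (forall j, P (val j) (x j)) -> forall j, P j (add_player xi x j).
Proof.
move=> Pi Po j; have [->|ji] := eqVneq j i; first by rewrite add_player_eq.
have := add_player_neq xi x (exist _ j ji) => /= ->; exact: (Po (exist _ j ji)).
Qed.

Lemma cvg_add_player {S : Type} (F : set_system S) {FF : Filter F} i
    (g : S -> 'rV[R]_(d i)) (h : S -> vec_others R d i)
    (a : 'rV[R]_(d i)) (b : vec_others R d i) :
  g @ F --> a -> (forall j, (fun s => h s j) @ F --> b j) ->
  (fun s => add_player (g s) (h s) : vec_profile R d) @ F -->
  (add_player a b : vec_profile R d).
Proof.
move=> ga hb; apply: cvg_prod_topology => j.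
have [->|ji] := eqVneq j i.
  by rewrite add_player_eq; under eq_fun do rewrite add_player_eq.
have E a' b' := @add_player_neq n _ i a' b' (exist _ j ji : opponent i).
rewrite /= in E; rewrite E; under eq_fun do rewrite E.
exact: (hb (exist _ j ji)).
Qed.

Lemma vec_others_hausdorff i : hausdorff_space (vec_others R d i).
Proof.
apply: (@hausdorff_product _ (fun j : opponent i => 'rV[R]_(d (val j)))) => j.
exact: norm_hausdorff.
Qed.

(** [drop_player] between Borel spaces, so that it can carry the structure of a
    measurable function. *)
Definition opponents_part i (x : borel (vec_profile R d)) :
  borel (vec_others R d i) := drop_player i x.

Arguments opponents_part i x : clear implicits.

Lemma measurable_opponents_part i : measurable_fun setT (opponents_part i).
Proof.
apply: (@within_continuous_measurable (vec_profile R d) (vec_others R d i)).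
  exact: measurableT.
by apply: continuous_subspaceT; exact: drop_player_continuous.
Qed.

HB.instance Definition _ i :=
  isMeasurableFun.Build _ _ _ _ (opponents_part i)
    (@measurable_opponents_part i).

End Profiles.

Arguments opponents_part {R n d} i x.

Section Enorm.
Context {R : realType} {m : nat}.
Implicit Types x y : 'rV[R]_m.

Lemma enorm_ge0 x : 0 <= enorm x.
Proof. exact: sqrtr_ge0. Qed.

Lemma ler_norm_enorm x : `|x| <= enorm x.
Proof.
rewrite [leLHS]mx_normrE; apply: bigmax_le; first exact: enorm_ge0.
move=> [i j] _ /=; rewrite ord1 -sqrtr_sqr ler_wsqrtr//.
rewrite (bigD1 j)//= lerDl; apply: sumr_ge0 => k _; exact: sqr_ge0.
Qed.

Lemma ler_enorm_norm x : enorm x <= Num.sqrt m%:R * `|x|.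
Proof.
rewrite -[`|x|]ger0_norm// -sqrtr_sqr -sqrtrM ?ler0n// ler_wsqrtr//.
apply: (@le_trans _ _ (\sum_(j < m) `|x| ^+ 2)); last first.
  by rewrite sumr_const card_ord mulr_natl.
apply: ler_sum => j _.
rewrite -real_normK ?num_real// lerXn2r ?nnegrE//.
rewrite [leRHS]mx_normrE.
exact: (le_bigmax _ (fun ij => `|x ij.1 ij.2|) (0, j)).
Qed.

Lemma near_enorm (A : set 'rV[R]_m) x e : 0 < e ->
  \forall y \near within A (nbhs x), enorm (x - y) < e.
Proof.
move=> e0; apply: cvg_within.
(* [+ 1] keeps the divisor positive when [m = 0] *)
have s0 : 0 < Num.sqrt m%:R + 1 :> R by rewrite ltr_wpDl ?sqrtr_ge0.
have := @cvg_id _ (nbhs x) => /cvgr_dist_lt /(_ (e / (Num.sqrt m%:R + 1))).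
rewrite divr_gt0// => /(_ isT); apply: filterS => y xy.
apply: le_lt_trans (ler_enorm_norm _) _.
apply: (@le_lt_trans _ _ ((Num.sqrt m%:R + 1) * `|x - y|)).
  by rewrite ler_wpM2r// lerDl.
by rewrite mulrC -ltr_pdivlMr.
Qed.

Lemma dist_set1 x y : dist_set x [set y] = enorm (x - y).
Proof. by rewrite /dist_set image_set1 inf1. Qed.

End Enorm.

(** * Best replies *)

Section Game.
Context {R : realType} {n : nat} (G : bayesian_game R n) (i : 'I_n).
Hypothesis utility_continuous :
  {within action_profiles G `*` type_profiles G,
    continuous (fun p : vec_profile R (adim G) * vec_profile R (tdim G) =>
      utility G i p.1 p.2)}.
Hypothesis actions_compact : forall j, compact (actions G j).
Hypothesis types_compact : forall j, compact (types G j).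

Lemma measurable_types j :
  measurable (types G j : set (borel 'rV[R]_(tdim G j))).
Proof.
apply: compact_measurable_borel; first exact: norm_hausdorff.
exact: types_compact.
Qed.

Lemma others_types_compact : compact (others_types G i).
Proof.
exact: (@tychonoff {j : 'I_n | j != i}
  (fun j : opponent i => 'rV[R]_(tdim G (val j)))
  (fun j => types G (val j)) (fun j => @types_compact _)).
Qed.

Lemma measurable_others_types :
  measurable (others_types G i : set (borel (vec_others R (tdim G) i))).
Proof.
apply: compact_measurable_borel; first exact: vec_others_hausdorff.
exact: others_types_compact.
Qed.

Lemma continuous_strategies_measurable j (g : strategy G j) :
  continuous_strategies G j g -> measurable_strategies G j g.
Proof.
move=> [fg cg]; split => //.
by apply: within_continuous_measurable => //; exact: measurable_types.
Qed.

Variable fo : others (strategy G) i.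
Arguments fo : clear implicits.
Hypothesis fo_continuous : forall j : opponent i,
  continuous_strategies G (val j) (fo j).

Lemma continuous_others_measurable : measurable_others G i fo.
Proof. by move=> j; apply: continuous_strategies_measurable. Qed.

Definition payoff (a : 'rV[R]_(adim G i)) (x : 'rV[R]_(tdim G i))
    (y : vec_others R (tdim G) i) : R :=
  utility G i (add_player a (fun j => fo j (y j))) (add_player x y).

(** The parameter [s] covers two uses: own action and opponents' types at a
    fixed own type, and all types when [i] follows a strategy. *)
Lemma payoff_continuous {S : topologicalType} (K : set S)
    (a : S -> 'rV[R]_(adim G i)) (x : S -> 'rV[R]_(tdim G i))
    (y : S -> vec_others R (tdim G) i) :
  (forall s, K s -> [/\ actions G i (a s), types G i (x s) &
    others_types G i (y s)]) ->
  {within K, continuous a} -> {within K, continuous x} ->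
  {within K, continuous y} ->
  {within K, continuous (fun s => payoff (a s) (x s) (y s))}.
Proof.
move=> Kaxy ca cx cy.
pose h s : vec_profile R (adim G) * vec_profile R (tdim G) :=
  (add_player (a s) (fun j => fo j (y s j)), add_player (x s) (y s)).
have cyj (j : opponent i) : {within K, continuous (fun s => y s j)}.
  move=> s; apply: cvg_comp (@cvg_coord_others _ _ _ _ j (y s)).
  exact: cy.
have cfo (j : opponent i) : {within K, continuous (fun s => fo j (y s j))}.
  have [_ cj] := fo_continuous j.
  by apply: within_comp_continuous (cyj j) cj => s /Kaxy[_ _]; exact.
apply: (within_comp_continuous (h := h) _ _ utility_continuous).
  move=> s /Kaxy[aA xT yT]; split.
    have := @add_playerP _ (fun j => 'rV[R]_(adim G j)) (actions G) i _
      (fun j => fo j (y s j)) aA; apply => j.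
    by have [fj _] := fo_continuous j; exact: fj (yT j).
  exact: (@add_playerP _ (fun j => 'rV[R]_(tdim G j)) (types G) i _ _ xT yT).
move=> s.
have ha := @cvg_add_player R n (adim G) _ _ (nbhs_filter (s : subspace K)) i a
  (fun s j => fo j (y s j)) (a s) (fun j => fo j (y s j)) (ca s)
  (fun j => cfo j s).
have hx := @cvg_add_player R n (tdim G) _ _ (nbhs_filter (s : subspace K)) i x y
  (x s) (y s) (cx s) (fun j => cyj j s).
exact: (cvg_pair ha hx).
Qed.

Lemma rho_action_continuous x : types G i x ->
  {within actions G i, continuous (fun a => rho G i a fo x)}.
Proof.
move=> Tx.
apply: (@within_continuous_Rintegral R _ (vec_others R (tdim G) i)
  (cond G i x) (actions G i) (others_types G i)
  (fun z => payoff z.1 x z.2)).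
- exact: measurable_others_types.
- exact: cond_types.
- exact: others_types_compact.
- apply: payoff_continuous.
  + by move=> [a y] [/=].
  + by apply: continuous_subspaceT => z; exact: cvg_fst.
  + by apply: continuous_subspaceT => z; exact: cvg_cst.
  + by apply: continuous_subspaceT => z; exact: cvg_snd.
Qed.

Definition best_reply (x : 'rV[R]_(tdim G i)) : set 'rV[R]_(adim G i) :=
  argmax (actions G i) (fun b => rho G i b fo x).

Lemma best_reply_exists x : types G i x -> exists a, best_reply x a.
Proof.
move=> Tx.
have [a /set_mem Aa amax] := compact_EVT_max (actions_neq0 _ _ G i)
  (@actions_compact i) (rho_action_continuous Tx).
by exists a; split=> // b Ab; apply: amax; exact: mem_set.
Qed.

(** The midpoint of two distinct maximizers would do strictly better. *)
Lemma best_reply_unique x a b :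
  convex_set (actions G i : set (convex_lmodType 'rV[R]_(adim G i))) ->
  strictly_quasiconcave (actions G i) (fun b => rho G i b fo x) ->
  best_reply x a -> best_reply x b -> a = b.
Proof.
move=> Aconv qc [Aa amax] [Ab bmax]; apply/eqP/negPn/negP => ab.
have h0 : 0 < 1 / 2 :> R by lra.
have h1 : 1 / 2 < 1 :> R by lra.
have Aab : actions G i (1 / 2 *: a + (1 - 1 / 2) *: b).
  by have := Aconv a b (Itv01 (ltW h0) (ltW h1)); rewrite !inE => /(_ Aa Ab).
have := qc a b (1 / 2) Aa Ab ab h0 h1.
by apply/negP; rewrite -leNgt le_min amax// bmax.
Qed.

Hypothesis actions_convex :
  convex_set (actions G i : set (convex_lmodType 'rV[R]_(adim G i))).
Hypothesis rho_quasiconcave : forall x, types G i x ->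
  strictly_quasiconcave (actions G i) (fun b => rho G i b fo x).
Variables alpha nu tau : R.
Hypotheses (alpha0 : 0 < alpha) (nu0 : 0 < nu) (tau0 : 0 < tau).
Hypothesis rho_growth : forall x, types G i x -> forall a, actions G i a ->
  - rho G i a fo x >= - maxval (actions G i) (fun b => rho G i b fo x) +
    alpha * dist_set a (best_reply x) `^ nu.
Hypothesis rho_lipschitz : forall a x x', actions G i a -> types G i x ->
  types G i x' -> `|rho G i a fo x - rho G i a fo x'| <= tau * enorm (x - x').

(** The set of maximizers being a singleton, the growth condition bounds the
    distance to the maximizer by the loss of payoff. *)
Lemma rho_growth_best_reply x a b : types G i x -> best_reply x a ->
  actions G i b ->
  alpha * enorm (b - a) `^ nu <= rho G i a fo x - rho G i b fo x.
Proof.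
move=> Tx ma Ab; have := rho_growth Tx Ab.
have -> : best_reply x = [set a].
  apply/seteqP; split=> [c mc|c ->//].
  exact: (best_reply_unique _ (rho_quasiconcave Tx)).
have -> : maxval (actions G i) (fun b => rho G i b fo x) = rho G i a fo x.
  have [Aa amax] := ma; apply/le_anti/andP; split.
    apply: ge_sup; first by exists (rho G i a fo x), a.
    by move=> _ [c Ac <-]; exact: amax.
  apply: ub_le_sup; last by exists a.
  by exists (rho G i a fo x) => _ [c Ac <-]; exact: amax.
rewrite dist_set1; lra.
Qed.

(** With [r] the distance of the two types, [a'] loses at most [2 * tau * r]
    at [x]: it is optimal at [x'], and the payoffs of [a] and of [a'] both
    change by at most [tau * r] between [x'] and [x]. *)
Lemma best_reply_holder x x' a a' : types G i x -> types G i x' ->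
  best_reply x a -> best_reply x' a' ->
  alpha * enorm (a' - a) `^ nu <= 2 * tau * enorm (x - x').
Proof.
move=> Tx Tx' ma ma'; have [[Aa _] [Aa' a'max]] := (ma, ma').
apply: le_trans (rho_growth_best_reply Tx ma Aa') _.
have := rho_lipschitz Aa Tx Tx'; have := rho_lipschitz Aa' Tx Tx'.
have := a'max _ Aa; rewrite !ler_norml => ? /andP[? ?] /andP[? ?]; lra.
Qed.

Lemma continuous_best_reply : exists2 h : strategy G i,
  continuous_strategies G i h & forall x, types G i x -> best_reply x (h x).
Proof.
have /choice[h hmax] : forall x, exists a, types G i x -> best_reply x a.
  (* [0] is an arbitrary value outside the type set *)
  move=> x; have [Tx|nTx] := pselect (types G i x); last by exists 0.
  by have [a ma] := best_reply_exists Tx; exists a.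
exists h => //; split; first by move=> x /hmax[].
apply/subspace_continuousP => x Tx; apply/cvgrPdist_lt => e e0.
have d0 : 0 < alpha * e `^ nu / (2 * tau).
  by rewrite divr_gt0 ?mulr_gt0 ?powR_gt0.
have := near_enorm (types G i) x d0; rewrite !near_withinE.
apply: filterS => x' xx' Tx'; rewrite ltNge; apply/negP => ehh.
have := xx' Tx'; apply/negP; rewrite -leNgt ler_pdivrMr ?mulr_gt0//.
rewrite [leRHS]mulrC.
apply: le_trans (best_reply_holder Tx Tx' (hmax _ Tx) (hmax _ Tx')).
rewrite ler_pM2l// ge0_ler_powR ?nnegrE ?enorm_ge0 ?(ltW nu0) ?(ltW e0)//.
by apply: le_trans ehh _; rewrite distrC; exact: ler_norm_enorm.
Qed.

Lemma rho_strategy_continuous g : continuous_strategies G i g ->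
  {within types G i, continuous (fun x => rho G i (g x) fo x)}.
Proof.
move=> [fg cg]; apply/subspace_continuousP => x Tx.
apply/cvgrPdist_lt => e e0.
have e2 : 0 < e / 2 by lra.
have et : 0 < e / 2 / tau by rewrite divr_gt0.
(* split the variation at the payoff of the new action at the old type *)
have : {within types G i, continuous (fun x' => rho G i (g x') fo x)}.
  exact: (within_comp_continuous fg cg (rho_action_continuous Tx)).
move=> /subspace_continuousP/(_ x Tx)/cvgrPdist_lt/(_ _ e2).
have := near_enorm (types G i) x et; rewrite !near_withinE.
apply: filterS2 => x' xx' gx' Tx'.
have A1 : `|rho G i (g x) fo x - rho G i (g x') fo x| < e / 2 := gx' Tx'.
have A2 := rho_lipschitz (fg _ Tx') Tx Tx'.
have A3 : tau * enorm (x - x') < e / 2.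
  by rewrite mulrC -ltr_pdivlMr//; exact: xx'.
rewrite /from_subspace -(subrKA (rho G i (g x') fo x)).
rewrite [e]splitr; apply: le_lt_trans (ler_normD _ _) _; apply: ltrD => //.
exact: le_lt_trans A2 A3.
Qed.

End Game.

(** * Expected utility *)

Lemma type_profilesE {R : realType} {n : nat} (G : bayesian_game R n) i :
  type_profiles G = [set th | types G i (@Defs.coord R n (tdim G) i th) /\
    others_types G i (opponents_part i th)].
Proof.
apply/seteqP; split=> [th Tth|th [Ti To] j]; first by split=> // j; exact: Tth.
by rewrite -(add_drop_player i th); exact: (@add_playerP _ _ (types G)).
Qed.

Lemma expected_utility_rho {R : realType} {n : nat} (G : bayesian_game R n) i
    (f : forall j, strategy G j) (g : strategy G i) :
  {within action_profiles G `*` type_profiles G,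
    continuous (fun p : vec_profile R (adim G) * vec_profile R (tdim G) =>
      utility G i p.1 p.2)} ->
  (forall j, compact (types G j)) ->
  (forall j, continuous_strategies G j (f j)) -> continuous_strategies G i g ->
  expected_utility G i g f =
  \int[distribution (prior G) (@Defs.coord R n (tdim G) i)]_(x in types G i)
    rho G i (g x) (drop_player i f) x.
Proof.
move=> cu cT cf [fg cg].
pose fo : others (strategy G) i := drop_player i f.
pose K : set ('rV[R]_(tdim G i) * vec_others R (tdim G) i) :=
  types G i `*` others_types G i.
pose F z := payoff fo (g z.1) z.1 z.2.
have cF : {within K, continuous F}.
  apply: payoff_continuous => //.
  - by move=> [x y] [/= Tx Ty]; split => //; exact: fg.
  - apply: (within_comp_continuous _ _ cg); first by move=> z [].
    by apply: continuous_subspaceT => z; exact: cvg_fst.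
  - by apply: continuous_subspaceT => z; exact: cvg_fst.
  - by apply: continuous_subspaceT => z; exact: cvg_snd.
have cK : compact K.
  by apply: compact_setX; [exact: cT|exact: others_types_compact].
have [M FM] := within_continuous_bounded cK cF.
have mT := @measurable_types R n G cT i.
have mO := @measurable_others_types R n G i cT.
rewrite /expected_utility (type_profilesE G i).
rewrite -(@Rintegral_disintegration _ _ _ _ _ _ R (prior G)
  (@Defs.coord R n (tdim G) i) (opponents_part i) (cond G i) _ _ _ F M)//.
- apply: eq_Rintegral => th _; rewrite /F /payoff.
  by congr (utility G i _ _); rewrite add_drop_player.
- exact: cond_prior.
- apply: within_continuous_measurable_prod => //.
  + exact: second_countable_rV.
  + exact: measurableX.
- by move=> x y Tx Ty; exact: FM.
Qed.

Section Marginal.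
Context {R : realType} {n : nat} (G : bayesian_game R n) (i : 'I_n).
Hypothesis types_compact : forall j, compact (types G j).

Local Notation eta := (distribution (prior G) (@Defs.coord R n (tdim G) i)).

Lemma marginal_types1 : eta (types G i) = 1%E.
Proof.
have mT := @measurable_types R n G types_compact i.
apply/eqP; rewrite eq_le probability_le1//=.
rewrite -(prior_types _ _ G); apply: le_measure; rewrite ?inE.
- rewrite [X in measurable X](type_profilesE G i); apply: measurableI.
    rewrite -[X in measurable X]setTI.
    exact: (@measurable_coord R n (tdim G) i).
  rewrite -[X in measurable X]setTI; apply: measurable_opponents_part => //.
  exact: measurable_others_types.
- rewrite -[X in measurable X]setTI.
  exact: (@measurable_coord R n (tdim G) i).
- by move=> th; exact.
Qed.

Lemma continuous_marginal_integrable (h : 'rV[R]_(tdim G i) -> R) :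
  {within types G i, continuous h} ->
  eta.-integrable (types G i) (EFin \o h).
Proof.
apply: within_continuous_integrable => //.
- exact: measurable_types.
- by rewrite [X in (X < _)%E]marginal_types1 ltry.
- exact: types_compact.
Qed.

(** Every type lies in the support of the marginal, so that an almost sure
    equality of continuous functions holds at every type. *)
Lemma eq_of_marginal_Rintegral_le (u v : 'rV[R]_(tdim G i) -> R) :
  {within types G i, continuous u} -> {within types G i, continuous v} ->
  (forall x, types G i x -> u x <= v x) ->
  \int[eta]_(x in types G i) v x <= \int[eta]_(x in types G i) u x ->
  forall x, types G i x -> u x = v x.
Proof.
move=> cu cv uv intvu x Tx.
have mT := @measurable_types R n G types_compact i.
have [iu iv] := (continuous_marginal_integrable cu,
  continuous_marginal_integrable cv).
have cvu : {within types G i, continuous (fun y => v y - u y)}.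
  by move=> y; exact: (cvgB (cv y) (cu y)).
apply/esym/subr0_eq.
apply: (eq0_of_Rintegral_le0 (mu := eta) mT _ _ _ cvu _ _ Tx).
- exact: marginal_types1.
- by rewrite marginal_support.
- exact: continuous_marginal_integrable.
- by move=> y Ty; rewrite subr_ge0; exact: uv.
- by rewrite RintegralB// subr_le0.
Qed.

End Marginal.

(** * Equilibria and ex ante optimality *)

Theorem theorem3p3 (R : realType) (n : nat) (G : bayesian_game R n)
  (utility_continuous : forall i : 'I_n,
    {within action_profiles G `*` type_profiles G,
      continuous (fun p : vec_profile R (adim G) * vec_profile R (tdim G) =>
        utility G i p.1 p.2)})
  (rho_quasiconcave : forall (i : 'I_n) (fo : others (strategy G) i)
      (x : 'rV[R]_(tdim G i)),
    measurable_others G i fo -> types G i x ->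
    strictly_quasiconcave (actions G i) (fun a => rho G i a fo x))
  (cond_continuous : forall (i : 'I_n)
      (S : set (borel (vec_others R (tdim G) i))),
    measurable S -> S `<=` others_types G i ->
    {within types G i, continuous (fun x : 'rV[R]_(tdim G i) => cond G i x S)})
  (rho_growth : forall i : 'I_n, exists alpha nu : R,
    [/\ 0 < alpha, 0 < nu &
      forall (fo : others (strategy G) i) (x : 'rV[R]_(tdim G i)),
        measurable_others G i fo -> types G i x ->
        forall a : 'rV[R]_(adim G i), actions G i a ->
          - rho G i a fo x >=
          - maxval (actions G i) (fun b => rho G i b fo x) +
          alpha * dist_set a
            (argmax (actions G i) (fun b => rho G i b fo x)) `^ nu])
  (rho_lipschitz : forall i : 'I_n, exists2 tau : R, 0 < tau &
    forall (a : 'rV[R]_(adim G i)) (fo : others (strategy G) i)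
        (x x' : 'rV[R]_(tdim G i)),
      actions G i a -> measurable_others G i fo -> types G i x ->
      types G i x' ->
      `|rho G i a fo x - rho G i a fo x'| <= tau * enorm (x - x'))
  (actions_compact : forall i : 'I_n, compact (actions G i))
  (actions_convex : forall i : 'I_n,
    convex_set (actions G i : set (convex_lmodType 'rV[R]_(adim G i))))
  (types_compact : forall i : 'I_n, compact (types G i))
  (types_convex : forall i : 'I_n,
    convex_set (types G i : set (convex_lmodType 'rV[R]_(tdim G i))))
  (f : forall i : 'I_n, strategy G i)
  (f_continuous : forall i : 'I_n, continuous_strategies G i (f i)) :
  (behavioural_equilibrium G f <->
    forall (i : 'I_n) (g : strategy G i), continuous_strategies G i g ->
      expected_utility G i (f i) f >= expected_utility G i g f) /\
  (behavioural_equilibrium G f <->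
    argmax
      [set g : forall i : 'I_n, strategy G i |
        forall i : 'I_n, continuous_strategies G i (g i)]
      (fun g => \sum_(i < n) expected_utility G i (g i) f) f).
Proof.
pose fo i : others (strategy G) i := drop_player i f.
have foP i (j : opponent i) : continuous_strategies G (val j) (fo i j).
  exact: f_continuous.
have foM i : measurable_others G i (fo i).
  by apply: continuous_others_measurable => //; exact: foP.
have rho_cont i (g : strategy G i) : continuous_strategies G i g ->
    {within types G i, continuous (fun x => rho G i (g x) (fo i) x)}.
  move=> cg; have [tau tau0 lip] := rho_lipschitz i.
  apply: (rho_strategy_continuous (utility_continuous i) types_compact (foP i)
    tau0) => //.
  by move=> a x x' Aa; exact: lip.
have euE i (g : strategy G i) : continuous_strategies G i g ->
    expected_utility G i g f = \int[distribution (prior G)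
      (@Defs.coord R n (tdim G) i)]_(x in types G i) rho G i (g x) (fo i) x.
  by move=> cg; exact: expected_utility_rho.
have eqP1 : behavioural_equilibrium G f <->
    forall (i : 'I_n) (g : strategy G i), continuous_strategies G i g ->
      expected_utility G i g f <= expected_utility G i (f i) f.
  split=> [[_ fmax] i g cg|nodev].
    rewrite !euE//; apply: le_Rintegral.
    - exact: measurable_types.
    - by apply: continuous_marginal_integrable => //; exact: rho_cont.
    - by apply: continuous_marginal_integrable => //; exact: rho_cont.
    - by move=> x Tx; have [_] := fmax i x Tx; apply; exact: cg.1.
  split=> [i|i x Tx]; first exact: continuous_strategies_measurable.
  have [alpha [nu [alpha0 nu0 growth]]] := rho_growth i.
  have [tau tau0 lip] := rho_lipschitz i.
  have [h ch hmax] : exists2 h : strategy G i, continuous_strategies G i h &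
      forall x, types G i x -> best_reply (fo i) x (h x).
    apply: (@continuous_best_reply R n G i (utility_continuous i)
      actions_compact types_compact (fo i) (foP i) (actions_convex i) _
      alpha nu tau) => //.
    - by move=> y; exact: rho_quasiconcave.
    - by move=> y Ty a; exact: growth.
    - by move=> a y y' Aa; exact: lip.
  have [_ hxmax] := hmax x Tx.
  split=> [|b Ab]; first exact: (f_continuous i).1.
  suff -> : rho G i (f i x) (fo i) x = rho G i (h x) (fo i) x by exact: hxmax.
  apply: (eq_of_marginal_Rintegral_le types_compact
    (rho_cont i (f i) (f_continuous i)) (rho_cont i h ch)) => //.
    by move=> y Ty; apply: (hmax y Ty).2; exact: (f_continuous i).1.
  by rewrite -!euE//; exact: nodev.
split => //; rewrite eqP1; split=> [nodev|[_ fmax] i g cg].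
  by split=> // g cg; apply: ler_sum => i _; exact: nodev.
(* the profile in which only player [i] deviates, to [g] *)
pose h : forall j, strategy G j := add_player g (drop_player i f).
have ch j : continuous_strategies G j (h j).
  exact: (@add_playerP _ _ (fun j => continuous_strategies G j)).
have := fmax h ch.
rewrite (bigD1 i)//= [leRHS](bigD1 i)//= {1}/h add_player_eq.
rewrite (eq_bigr (fun j => expected_utility G j (f j) f)) ?lerD2r// => j ji.
by rewrite /h (@add_player_neq _ (strategy G) _ g _ (exist _ j ji)).
Qed.
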